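(* Let $d\ge1$ be an integer, let $\mathcal G$ be a graph class of copying shrub-depth $d$, and let $\tau$ be a $\mathrm{CMSO}_1$ transduction. Then the copying shrub-depth of $\tau(\mathcal G)$ is at most $d$, i.e., $\tau(\mathcal G)\subseteq\mathrm{TMC}_d^{m',k'}$ for some $m',k'$.
   Context: All graphs are finite, simple and undirected. A tree-model of $m$ colours and depth $d$ of a graph $G$ is a rooted tree $T$ with a set $S\subseteq\{1,\dots,m\}^2\times\{1,\dots,d\}$ such that: every root-to-leaf path has length exactly $d$; the leaves are exactly $V(G)$; each leaf gets one of colours $1,\dots,m$; $(i,j,\ell)\in S$ iff $(j,i,\ell)\in S$; and for distinct $u,v\in V(G)$ coloured $i,j$ at distance $2\ell$ in $T$, $uv\in E(G)$ iff $(i,j,\ell)\in S$. A graph $G$ has a $k$-copied tree-model of $m$ colours and depth $d$ if $G$ has a tree-model of $m$ colours and depth $d+1$ in which every node at distance $d$ from the root has at most $k$ leaf descendants; $\mathrm{TMC}_d^{m,k}$ is the class of such graphs. A class $\mathcal G$ has copying shrub-depth $d$ if $\mathcal G\subseteq\mathrm{TMC}_d^{m,k}$ for some $m,k$ but $\mathcal G\not\subseteq \mathrm{TMC}_{d-1}^{m',k'}$ for all $m',k'$; copying shrub-depth at most $d$ means $\mathcal G\subseteq\mathrm{TMC}_d^{m,k}$ for some $m,k$. $\mathrm{CMSO}_1$ logic over relational structures: element and set variables, equality, quantifiers over elements and sets, Boolean connectives, membership, the relation symbols, and predicates $\mathrm{mod}_{a,b}(X)$ holding iff $|X|\bmod b=a$.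 A basic $\mathrm{CMSO}_1$ graph transduction $(\chi,\nu,\mu)$ ($\chi$ a sentence, $\nu$ with one and $\mu$ with two free element variables, $\mu$ symmetric) maps a structure $A$ with $A\models\chi$ to the graph with vertices $\{v:A\models\nu(v)\}$ and edges $\{u,v\}$, $u\neq v$, with $A\models\nu(u)\wedge\nu(v)\wedge\mu(u,v)$ (undefined if $A\not\models\chi$). The expansion by $p$ unary predicates maps a (labelled) graph $G$ to the set of all its expansions by $p$ new arbitrary unary predicates. The $k$-copy operation maps such a structure $G$ to the structure $G^{\times k}$ with universe $V(G)\times\{1,\dots,k\}$ in which each $V(G)\times\{i\}$ carries a copy of $G$ (edges and unary predicates), there are no edges between distinct copies, and there are additional relations $\sim$ with $(u,i)\sim(v,j)$ iff $u=v$, and unary $P_i=V(G)\times\{i\}$. A $\mathrm{CMSO}_1$ transduction is a composition $\tau=\tau_1\circ\gamma\circ\varepsilon$ with $\varepsilon$ an expansion by some $p$ unary predicates, $\gamma$ a $k$-copy operation for some $k$, and $\tau_1$ a basic $\mathrm{CMSO}_1$ graph transduction; $\tau(\mathcal G)=\bigcup_{G\in\mathcal G}\tau(G)$. *)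

(* Defs.v *)
From HB Require Import structures.
From mathcomp Require Import all_boot.

Set Implicit Arguments.
Unset Strict Implicit.
Unset Printing Implicit Defensive.

Record sgraph := SGraph {
  vertex :> finType;
  edge : rel vertex;
  edge_sym : symmetric edge;
  edge_irrefl : irreflexive edge }.

Definition graph_iso (G H : sgraph) : Prop :=
  exists2 f : G -> H, bijective f & {mono f : u v / edge u v}.

Definition graph_class := sgraph -> Prop.

Definition subclass (C D : graph_class) : Prop := forall G, C G -> D G.

(* A finite rooted tree given by its parent map.  Reachability from a
   parentless node excludes cycles, and uniqueness of the parentless node makes
   the forest a tree.  The null tree is allowed: it has no root and no leaf,
   and is what serves as tree-model of the empty graph. *)
Record rtree := RTree {
  node :> finType;
  parent : node -> option node;
  root_unique : forall r s, parent r = None -> parent s = None -> r = s;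
  root_reach : forall x, exists2 r, parent r = None
                 & connect (fun y z => parent z == Some y) r x }.

Definition child (T : rtree) : rel T := fun x y => parent y == Some x.

Definition is_root (T : rtree) (x : T) : bool := parent x == None.

Definition is_leaf (T : rtree) (x : T) : bool := [forall y, ~~ child x y].

Definition descendant (T : rtree) (x y : T) : bool := connect (@child T) x y.

Definition tadj (T : rtree) : rel T := fun x y => child x y || child y x.

Definition tdist (T : rtree) (x y : T) (n : nat) : Prop :=
  (exists p, [/\ path (@tadj T) x p, last x p = y & size p = n]) /\
  (forall p, path (@tadj T) x p -> last x p = y -> n <= size p).

Record tree_model (m d : nat) (G : sgraph) := TreeModel {
  tm_tree : rtree;
  tm_leaf : G -> tm_tree;
  tm_col : G -> 'I_m;
  tm_sig : 'I_m -> 'I_m -> nat -> bool;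
  tm_depth : forall r x : tm_tree, is_root r -> is_leaf x -> tdist r x d;
  tm_leaf_inj : injective tm_leaf;
  tm_leaf_im : forall x : tm_tree, is_leaf x <-> exists v, tm_leaf v = x;
  tm_sig_range : forall i j l, tm_sig i j l -> 1 <= l <= d;
  tm_sig_sym : forall i j l, tm_sig i j l = tm_sig j i l;
  tm_edge : forall (u v : G) (l : nat), u != v ->
    tdist (tm_leaf u) (tm_leaf v) (2 * l) ->
    edge u v = tm_sig (tm_col u) (tm_col v) l }.

Definition TMC (d m k : nat) : graph_class := fun G =>
  exists M : tree_model m d.+1 G, forall r x : tm_tree M,
    is_root r -> tdist r x d ->
    #|[set y : tm_tree M | is_leaf y && descendant x y]| <= k.

Definition copying_sd_le (d : nat) (C : graph_class) : Prop :=
  exists m k, subclass C (TMC d m k).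

Definition copying_sd (d : nat) (C : graph_class) : Prop :=
  copying_sd_le d C /\
  forall d' m k, d = d'.+1 -> ~ subclass C (TMC d' m k).

(* Finite structures over a vocabulary with unary symbols U and binary symbols
   B; no other arity occurs in graphs, their expansions and their copies. *)
Record structure (U B : Type) := Structure {
  dom :> finType;
  un : U -> pred dom;
  bi : B -> rel dom }.

(* Well-scoped de Bruijn syntax: [cmso U B n s] is the type of formulas with n
   free element variables and s free set variables; each quantifier binds
   index 0 and shifts the others. *)
Inductive cmso (U B : Type) : nat -> nat -> Type :=
| FEq n s of 'I_n & 'I_n : cmso U B n s
| FMem n s of 'I_n & 'I_s : cmso U B n s
| FUn n s of U & 'I_n : cmso U B n s
| FBi n s of B & 'I_n & 'I_n : cmso U B n s
| FMod n s (b : nat) (a : 'I_b) of 'I_s : cmso U B n s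
| FNot n s of cmso U B n s : cmso U B n s
| FAnd n s of cmso U B n s & cmso U B n s : cmso U B n s
| FOr n s of cmso U B n s & cmso U B n s : cmso U B n s
| FExElt n s of cmso U B n.+1 s : cmso U B n s
| FAllElt n s of cmso U B n.+1 s : cmso U B n s
| FExSet n s of cmso U B n s.+1 : cmso U B n s
| FAllSet n s of cmso U B n s.+1 : cmso U B n s.

Definition vnil {T : Type} : 'I_0 -> T :=
  fun i => False_rect T (notF (valP i)).

Definition vcons {T : Type} {n : nat} (x : T) (f : 'I_n -> T) : 'I_n.+1 -> T :=
  fun i => oapp f x (unlift ord0 i).

Fixpoint eval (U B : Type) (A : structure U B) (n s : nat) (phi : cmso U B n s)
    : ('I_n -> A) -> ('I_s -> {set A}) -> bool :=
  match phi in cmso _ _ n s return ('I_n -> A) -> ('I_s -> {set A}) -> bool with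
  | FEq _ _ i j => fun e _ => e i == e j
  | FMem _ _ i X => fun e E => e i \in E X
  | FUn _ _ P i => fun e _ => un P (e i)
  | FBi _ _ R i j => fun e _ => bi R (e i) (e j)
  | FMod _ _ b a X => fun _ E => #|E X| %% b == a
  | FNot _ _ f => fun e E => ~~ eval f e E
  | FAnd _ _ f g => fun e E => eval f e E && eval g e E
  | FOr _ _ f g => fun e E => eval f e E || eval g e E
  | FExElt _ _ f => fun e E => [exists x : A, eval f (vcons x e) E]
  | FAllElt _ _ f => fun e E => [forall x : A, eval f (vcons x e) E]
  | FExSet _ _ f => fun e E => [exists X : {set A}, eval f e (vcons X E)]
  | FAllSet _ _ f => fun e E => [forall X : {set A}, eval f e (vcons X E)]
  end.

Definition holds0 (U B : Type) (A : structure U B) (f : cmso U B 0 0) : bool :=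
  @eval U B A 0 0 f vnil vnil.

Definition holds1 (U B : Type) (A : structure U B) (f : cmso U B 1 0) (x : A)
  : bool := @eval U B A 1 0 f (vcons x vnil) vnil.

Definition holds2 (U B : Type) (A : structure U B) (f : cmso U B 2 0) (x y : A)
  : bool := @eval U B A 2 0 f (vcons x (vcons y vnil)) vnil.

Record basic_transduction (U B : Type) := BasicTransduction {
  bt_chi : cmso U B 0 0;
  bt_nu : cmso U B 1 0;
  bt_mu : cmso U B 2 0;
  bt_mu_sym : forall (A : structure U B) (x y : A),
    holds2 bt_mu x y = holds2 bt_mu y x }.

Definition basic_vertex (U B : Type) (t : basic_transduction U B)
  (A : structure U B) : finType := {x : A | holds1 (bt_nu t) x}.

Definition basic_edge (U B : Type) (t : basic_transduction U B)
  (A : structure U B) : rel (basic_vertex t A) :=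
  fun x y => (x != y) && holds2 (bt_mu t) (val x) (val y).

Lemma basic_edge_sym (U B : Type) (t : basic_transduction U B)
  (A : structure U B) : symmetric (@basic_edge U B t A).
Proof. by move=> x y; rewrite /basic_edge eq_sym bt_mu_sym. Qed.

Lemma basic_edge_irrefl (U B : Type) (t : basic_transduction U B)
  (A : structure U B) : irreflexive (@basic_edge U B t A).
Proof. by move=> x; rewrite /basic_edge eqxx. Qed.

(* Meaningful only when A satisfies [bt_chi t]. *)
Definition basic_graph (U B : Type) (t : basic_transduction U B)
  (A : structure U B) : sgraph :=
  SGraph (@basic_edge_sym U B t A) (@basic_edge_irrefl U B t A).

Variant edge_symbol := Edge.

Definition expand (p : nat) (G : sgraph) (Q : 'I_p -> {set G})
  : structure 'I_p edge_symbol :=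
  @Structure 'I_p edge_symbol G
    (fun i v => v \in Q i) (fun _ u v => edge u v).

(* The unary symbol [inr i] is P_i, and the binary symbol [None] is ~. *)
Definition copy (k : nat) (U B : Type) (A : structure U B)
  : structure (U + 'I_k) (option B) :=
  @Structure (U + 'I_k) (option B) (A * 'I_k)%type
    (fun P x => match P with
                | inl P0 => un P0 x.1
                | inr i => x.2 == i
                end)
    (fun R x y => match R with
                  | Some R0 => (x.2 == y.2) && bi R0 x.1 y.1
                  | None => x.1 == y.1
                  end).

Record transduction := Transduction {
  td_p : nat;
  td_k : nat;
  td_basic : basic_transduction ('I_td_p + 'I_td_k) (option edge_symbol) }.

(* H belongs to tau(G); graphs are taken up to isomorphism. *)
Definition transduces (tau : transduction) (G H : sgraph) : Prop :=
  exists Q : 'I_(td_p tau) -> {set G},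
    let A := copy (td_k tau) (expand Q) in
    holds0 A (bt_chi (td_basic tau)) /\
    graph_iso H (basic_graph (td_basic tau) A).

Definition image_class (tau : transduction) (C : graph_class) : graph_class :=
  fun H => exists2 G, C G & transduces tau G H.

(* Main.v *)
Require Import Defs.
From HB Require Import structures.
From mathcomp Require Import all_boot zify.

(** A copied tree-model is the same thing as a nested family of partitions of the
vertex set, the finest having bounded blocks ("bags"), together with a bounded
colouring such that adjacency of two vertices depends only on their colours and
on the levels at which they share a block.  Once the vertices of a bag get
distinct colours, the whole copied structure is of this kind: every atomic
formula depends only on colours and shared levels.

The type of a coloured block records the types of its sub-blocks with their
multiplicities counted exactly below a threshold [t] and modulo [M] above it, so
there are boundedly many types.  Elements and sets assigned to variables are
just additional colours, and a back-and-forth argument, paying with larger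
thresholds, shows that types determine the truth of CMSO formulas.  Finally, the
type of the structure with [x] and [y] marked depends only on the types, marked
and unmarked, of the blocks around [x], of those around [y], and on the levels
that [x] and [y] share; these block types are the new colours, and the nested
partitions, hence the depth, do not change. *)

Set Implicit Arguments.
Unset Strict Implicit.
Unset Printing Implicit Defensive.

(** * Truncated multiplicities *)

Section ReducedCounts.

Variable M : nat.
Hypothesis M_gt0 : 0 < M.

(* Remembers [n] exactly below the threshold [t], and modulo [M] above it. *)
Definition red t n := if n < t then n else t + (n - t) %% M.

Lemma red_lt t n : red t n < t + M.
Proof.
rewrite /red; case: (ltnP n t) => [lt_nt|_]; first exact: ltn_addr.
by rewrite ltn_add2l ltn_pmod.
Qed.

Lemma red_mod t n : red t n = n %[mod M].
Proof.
rewrite /red; case: ltnP => // le_tn.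
by rewrite modnDmr subnKC.
Qed.

Lemma redE t a b :
  (red t a == red t b) = (a == b) || [&& t <= a, t <= b & a == b %[mod M]].
Proof.
have mE n : t <= n -> (n = t + (n - t)) by lia.
rewrite /red; case: (ltnP a t) => lta; case: (ltnP b t) => ltb /=.
- by rewrite orbF.
- by rewrite orbF; apply/eqP/eqP; lia.
- by rewrite orbF; apply/eqP/eqP; lia.
- rewrite eqn_add2l {3}(mE _ lta) {3}(mE _ ltb) eqn_modDl.
  by case: (a =P b) => [->|]; rewrite ?eqxx.
Qed.

Lemma redP t a b :
  red t a = red t b <-> a = b \/ [/\ t <= a, t <= b & a = b %[mod M]].
Proof.
split=> [/eqP|ab].
  by rewrite redE => /orP[/eqP|/and3P[? ? /eqP]]; [left | right].
by apply/eqP; rewrite redE; case: ab => [->|[-> -> ->]]; rewrite eqxx ?orbT.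
Qed.

Lemma red_red t n : red t (red t n) = red t n.
Proof.
apply/redP; rewrite red_mod /red.
by case: ltnP => [|le_tn]; [left | right; split=> //; apply: leq_addr].
Qed.

Lemma redD t a a' b b' :
  red t a = red t a' -> red t b = red t b' -> red t (a + b) = red t (a' + b').
Proof.
move=> /redP ea /redP eb; apply/redP.
case: ea => [->|[? ? ma]]; case: eb => [->|[? ? mb]]; first by left.
- by right; split; [lia | lia | rewrite -modnDmr mb modnDmr].
- by right; split; [lia | lia | rewrite -modnDml ma modnDml].
- right; split; [lia | lia |].
  by rewrite -modnDml ma modnDml -modnDmr mb modnDmr.
Qed.

Lemma red_sum t (I : finType) (P : pred I) (F G : I -> nat) :
  (forall i, P i -> red t (F i) = red t (G i)) ->
  red t (\sum_(i | P i) F i) = red t (\sum_(i | P i) G i).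
Proof.
move=> FG; apply: (big_ind2 (fun a b => red t a = red t b)) => //.
by move=> a a' b b'; apply: redD.
Qed.

Lemma red_geq t j a b : red t a = red t b -> j <= t -> j <= a -> j <= b.
Proof. by move/redP => [->|[]] //; lia. Qed.

(* Deleting one element from each side costs one unit of threshold. *)
Lemma red_exchange t a a' b b' (i j : bool) : red t.+1 b = red t.+1 b' ->
  a + i = b + j -> a' + i = b' + j -> red t a = red t a'.
Proof.
move=> /redP [->|[? ? mb]] ea ea'; apply/redP; first by left; lia.
right; split; [lia | lia |].
by apply/eqP; rewrite -(eqn_modDr i) ea ea' eqn_modDr mb.
Qed.

(** When both totals reach [T], the bound on [T] forces some [n s0] to reach [t]. Replacing every
    [n s] by [red t (n s)] keeps the sum below [T]; the missing amount, a multiple of [M], is added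
    at [s0], where [red] ignores it. *)
Lemma redistribute (S : finType) t T (n : S -> nat) b :
  #|S| * (t + M) < T -> red T (\sum_s n s) = red T b ->
  exists2 n' : S -> nat, \sum_s n' s = b & forall s, red t (n s) = red t (n' s).
Proof.
move=> ltT /redP[<-|[leTa leTb mab]]; first by exists n.
have cS j : \sum_(s : S) j = #|S| * j.
  by rewrite sum_nat_const; congr (_ * _); apply: eq_card.
have [s0 les0|all_lt] := pickP (fun s => t <= n s); last first.
  have: \sum_s n s <= \sum_(s : S) t.
    by apply: leq_sum => s _; have := all_lt s; lia.
  by rewrite cS; move: ltT; rewrite mulnDr; lia.
set m := \sum_s red t (n s).
have ltm : m <= b.
  apply: leq_trans leTb; apply: leq_trans (ltnW ltT).
  by rewrite -cS; apply: leq_sum => s _; apply/ltnW/red_lt.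
have mb : m = b %[mod M].
  rewrite -mab /m; elim/big_rec2: _ => // s a c _ ac.
  by rewrite -modnDml red_mod modnDml -modnDmr ac modnDmr.
exists (fun s => red t (n s) + (s == s0) * (b - m)).
  rewrite big_split /= -/m (bigD1 s0) //= eqxx mul1n big1 ?addn0 ?subnKC //.
  by move=> s /negbTE->.
move=> s; have [->|_] := eqVneq s s0; last by rewrite addn0 red_red.
apply/redP; right; split=> //.
  by apply: leq_trans (leq_addr _ _); rewrite /red ltnNge les0 leq_addr.
rewrite mul1n -modnDml red_mod modnDml -[LHS](modnDr _ 0) addn0 -{1}(addn0 (n s0)).
apply/eqP; rewrite eqn_modDl mod0n eq_sym -/(dvdn M (b - m)).
by rewrite -eqn_mod_dvd // mb.
Qed.

End ReducedCounts.

(** * Maps with prescribed fibre sizes *)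

Lemma function_with_fibres (X S : finType) (Z : {set X}) (n : S -> nat) (s0 : S) :
  \sum_s n s = #|Z| ->
  exists g : X -> S, forall s, #|[set z in Z | g z == s]| = n s.
Proof.
(* [l] repeats each [s] [n s] times, so it is as long as [Z], and [g] matches the two lists by
   position. Points outside [Z] get the default [s0]. *)
move=> nZ; pose l := flatten [seq nseq (n s) s | s <- enum S].
have sz : size l = size (enum Z).
  rewrite -cardE -nZ size_flatten /shape -map_comp sumnE big_map big_enum /=.
  by apply: eq_bigr => s _; rewrite size_nseq.
pose g z := nth s0 l (index z (enum Z)); exists g => s.
have gl : map g (enum Z) = l.
  apply: (@eq_from_nth _ s0); rewrite size_map // => i lti.
  case: (enum Z) sz lti (enum_uniq Z) @g => [|x0 e] // sz lti ue g.
  by rewrite (nth_map x0) // /g index_uniq.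
transitivity (count (pred1 s) l); last first.
  rewrite count_flatten -map_comp sumnE big_map big_enum /= (bigD1 s) //= big1.
    by rewrite count_nseq /= eqxx mul1n addn0.
  by move=> s' ne; rewrite count_nseq /= (negbTE ne).
rewrite -gl count_map -size_filter cardE /enum_mem -filter_predI.
congr size; rewrite -[Finite.enum X]enumT; apply: eq_filter => z.
by rewrite !inE andbC.
Qed.

Lemma card_fibres (X T : finType) (Z : {set X}) (g : X -> T) (P : pred T) :
  #|[set z in Z | P (g z)]| = \sum_(s | P s) #|[set z in Z | g z == s]|.
Proof.
rewrite -sum1_card (partition_big g P) /=; last by move=> z; rewrite inE => /andP[].
apply: eq_bigr => s Ps; rewrite -sum1_card; apply: eq_bigl => z.
by rewrite !inE; case: eqP => [->|]; rewrite ?Ps ?andbT ?andbF.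
Qed.

(** Inside each fibre of [p] the fibre sizes of [g] are redistributed over the matching fibre of
    [p']. As [0 < t], a value occurs there for [g'] only if it occurs for [g]. *)
Lemma transfer_fibres M t T1 (X S T : finType) (Z Z' : {set X})
    (p p' : X -> T) (g : X -> S) (s0 : S) :
  0 < M -> 0 < t -> #|S| * (t + M) < T1 ->
  (forall u, red M T1 #|[set z in Z | p z == u]|
           = red M T1 #|[set z in Z' | p' z == u]|) ->
  exists g' : X -> S,
    (forall z', z' \in Z' -> exists z, [/\ z \in Z, p z = p' z' & g z = g' z']) /\
    (forall s, red M t #|[set z in Z | g z == s]|
             = red M t #|[set z in Z' | g' z == s]|).
Proof.
move=> M0 t0 ltT ZZ'.
pose Zu u := [set z in Z | p z == u]; pose Zu' u := [set z in Z' | p' z == u].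
have /fin_all_exists[g' g'P] : forall u, exists gu : X -> S, forall s,
    red M t #|[set z in Zu u | g z == s]| = red M t #|[set z in Zu' u | gu z == s]|.
  move=> u; pose n s := #|[set z in Zu u | g z == s]|.
  have sn : \sum_s n s = #|Zu u|.
    rewrite -(card_fibres (Zu u) g xpredT).
    by apply: eq_card => z; rewrite !inE andbT.
  have [|n' sn' nn'] := redistribute M0 ltT (n := n) (b := #|Zu' u|).
    by rewrite sn; exact: ZZ'.
  have [gu guE] := function_with_fibres s0 sn'.
  by exists gu => s; rewrite guE -nn'.
exists (fun z => g' (p' z) z); split=> [z' Zz'|s].
  have e := g'P (p' z') (g' (p' z') z').
  have: 0 < #|[set z in Zu (p' z') | g z == g' (p' z') z']|.
    apply: (red_geq M0 (esym e) t0); apply/card_gt0P; exists z'.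
    by rewrite !inE Zz' !eqxx.
  by case/card_gt0P => z; rewrite !inE => /andP[/andP[? /eqP ?] /eqP ?]; exists z.
have split_by (Y : {set X}) (q : X -> T) (f : X -> S) :
    #|[set z in Y | f z == s]| =
    \sum_u #|[set z in [set z in Y | q z == u] | f z == s]|.
  rewrite -[LHS]sum1_card (partition_big q xpredT) //=.
  apply: eq_bigr => u _; rewrite -sum1_card; apply: eq_bigl => z.
  by rewrite !inE andbAC.
rewrite (split_by Z p) (split_by Z' p'); apply: red_sum => // u _.
rewrite g'P; congr red; apply: eq_card => z; rewrite !inE.
by case: eqP => [->|]; rewrite ?andbF.
Qed.

(** * Types of coloured blocks *)

(** For a colouring injective on bags, the set of colours describes a bag completely. The successor
    in ['I_(t + M).+1] is there for [inord]. *)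
Fixpoint block_type (M t : nat) (C : finType) (h : nat) : finType :=
  if h is h'.+1 then {ffun block_type M t C h' -> 'I_(t + M).+1} else {set C}.

Definition mult M t (C : finType) h (F : block_type M t C h.+1)
  (u : block_type M t C h) : nat := (F : {ffun block_type M t C h -> 'I_(t + M).+1}) u.

Lemma mult_inj M t (C : finType) h (F G : block_type M t C h.+1) :
  mult F =1 mult G -> F = G.
Proof. by move=> FG; apply/ffunP => u; apply/val_inj/FG. Qed.

(* [r h x] is a chosen representative of the height-[h] block of [x]. *)
Definition nested (X : Type) (r : nat -> X -> X) :=
  (forall h x, r h (r h x) = r h x) /\ (forall h x, r h.+1 (r h x) = r h.+1 x).

Section Types.

Variables (X : finType) (r : nat -> X -> X).
Hypothesis r_nested : nested r.
Variable M : nat.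
Hypothesis M_gt0 : 0 < M.

Lemma nested_idem h x : r h (r h x) = r h x.
Proof. by case: r_nested. Qed.

Lemma nested_step h x : r h.+1 (r h x) = r h.+1 x.
Proof. by case: r_nested. Qed.

Lemma nested_succ h x y : r h x = r h y -> r h.+1 x = r h.+1 y.
Proof. by move=> e; rewrite -nested_step e nested_step. Qed.

Lemma nested_le h l x y : h <= l -> r h x = r h y -> r l x = r l y.
Proof.
move=> le e; rewrite -(subnKC le); elim: (l - h) => [|j IH]; first by rewrite addn0.
by rewrite addnS; apply: nested_succ.
Qed.

(** The height-[h] sub-blocks of the height-[h.+1] block of [x], each listed once by its
    representative. *)
Definition kids h x := [set z | (r h z == z) && (r h.+1 z == r h.+1 x)].

Lemma kidsP h x z : reflect (r h z = z /\ r h.+1 z = r h.+1 x) (z \in kids h x).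
Proof. by rewrite inE; apply: (iffP andP) => -[/eqP ? /eqP ?]. Qed.

Lemma rep_kids h x y : r h.+1 y = r h.+1 x -> r h y \in kids h x.
Proof. by move=> e; apply/kidsP; rewrite nested_idem nested_step. Qed.

(* The isomorphism type of the height-[h] block of [x] coloured by [c], up to
   the reduced multiplicities of the types of its sub-blocks. *)
Fixpoint tp t (C : finType) (c : X -> C) h x : block_type M t C h :=
  if h is h'.+1 return block_type M t C h then
    [ffun u => inord (red M t #|[set z in kids h' x | tp t c h' z == u]|)]
  else [set c y | y : X & r 0 y == r 0 x].

Definition cnt t (C : finType) (c : X -> C) h x (u : block_type M t C h) :=
  #|[set z in kids h x | tp t c h z == u]|.

Section Fixed.
Variable t : nat.

Lemma tpS (C : finType) (c : X -> C) h x (u : block_type M t C h) :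
  mult (tp t c h.+1 x) u = red M t (cnt c x u).
Proof. by rewrite /mult /= ffunE inordK // ltnW // ltnS red_lt. Qed.

Lemma tpS_eq (C : finType) (c c' : X -> C) h x x' :
  tp t c h.+1 x = tp t c' h.+1 x' <->
  forall u : block_type M t C h, red M t (cnt c x u) = red M t (cnt c' x' u).
Proof.
split=> [e u|e]; first by rewrite -!tpS e.
by apply: mult_inj => u; rewrite !tpS.
Qed.

Lemma kids_eq h x y : r h.+1 x = r h.+1 y -> kids h x = kids h y.
Proof. by move=> e; apply/setP => z; rewrite !inE e. Qed.

Lemma tp_block (C : finType) (c : X -> C) h x y :
  r h x = r h y -> tp t c h x = tp t c h y.
Proof. by case: h => [|h] e; rewrite /= ?e // (kids_eq e). Qed.

Lemma tp_ext (C : finType) (c c' : X -> C) h x :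
  (forall y, r h y = r h x -> c y = c' y) -> tp t c h x = tp t c' h x.
Proof.
elim: h x => [|h IH] x cc'.
  by apply: eq_in_imset => y; rewrite inE => /eqP /cc'.
apply/tpS_eq => u; congr red; apply: eq_card => z; rewrite inE [in RHS]inE.
have [/kidsP[_ zx]|//] := boolP (z \in kids h x).
by rewrite IH // => y /nested_succ e; apply: cc'; rewrite e.
Qed.

(** Recolouring can merge types, so multiplicities are added and reduced again; this is sound
    because [red] respects sums. *)
Fixpoint map_type (C C' : finType) (phi : C -> C') h :
    block_type M t C h -> block_type M t C' h :=
  if h is h'.+1 return block_type M t C h -> block_type M t C' h then
    fun F => [ffun v => inord (red M t (\sum_(u | map_type phi u == v) mult F u))]
  else fun S => phi @: (S : {set C}).

Lemma tp_map (C C' : finType) (phi : C -> C') (c : X -> C) h x :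
  tp t (phi \o c) h x = map_type phi (tp t c h x).
Proof.
elim: h x => [|h IH] x; first by rewrite /= imset_comp.
apply: mult_inj => v; rewrite tpS /mult [in RHS]ffunE inordK; last first.
  by rewrite ltnW // ltnS red_lt.
rewrite /cnt.
have -> : [set z in kids h x | tp t (phi \o c) h z == v] =
          [set z in kids h x | map_type phi (tp t c h z) == v].
  by apply/setP => z; rewrite !inE IH.
rewrite (card_fibres _ (tp t c h) (fun u => map_type phi u == v)).
by apply: red_sum => // u _; rewrite tpS red_red.
Qed.

Lemma tp_recolour (C C' : finType) (phi : C -> C') (c c' : X -> C) d d' h x x' :
  d =1 phi \o c -> d' =1 phi \o c' ->
  tp t c h x = tp t c' h x' -> tp t d h x = tp t d' h x'.
Proof.
move=> dE dE' e; rewrite (@tp_ext _ d (phi \o c)) // (@tp_ext _ d' (phi \o c')) //.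
by rewrite (tp_map phi c) (tp_map phi c') e.
Qed.

Fixpoint type_size (C : finType) (P : pred C) h : block_type M t C h -> nat :=
  if h is h'.+1 return block_type M t C h -> nat then
    fun F => \sum_u mult F u * type_size P u
  else fun S => #|[set k in (S : {set C}) | P k]|.

Definition bag_injective (C : Type) (c : X -> C) :=
  forall x y, r 0 x = r 0 y -> c x = c y -> x = y.

(** On a bag, injectivity makes counting colours the same as counting elements; higher up, sizes add
    and reduced multiplicities stay correct modulo [M]. This decides the modular predicates. *)
Lemma type_sizeE (C : finType) (P : pred C) (c : X -> C) h x :
  bag_injective c ->
  #|[set y | (r h y == r h x) && P (c y)]| = type_size P (tp t c h x) %[mod M].
Proof.
move=> cinj; elim: h x => [|h IH] x /=.
  rewrite -(@card_in_imset _ _ c); last first.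
    by move=> y z; rewrite !inE => /andP[/eqP ey _] /andP[/eqP ez _]; apply: cinj; rewrite ey.
  congr (_ %% _); apply: eq_card => k; rewrite !inE.
  apply/imsetP/andP => [[y]|[/imsetP[y yx ->] Pk]].
    by rewrite inE => /andP[yx Pc] ->; split=> //; apply/imsetP; exists y; rewrite ?inE.
  by exists y => //; move: yx; rewrite !inE => ->.
rewrite -sum1_card (partition_big (r h) (mem (kids h x))) /=; last first.
  by move=> y; rewrite inE => /andP[/eqP e _]; apply: rep_kids.
have -> : \sum_(z in kids h x) \sum_(y in [set y | (r h.+1 y == r h.+1 x) && P (c y)] | r h y == z) 1
   = \sum_(z in kids h x) #|[set y | (r h y == r h z) && P (c y)]|.
  apply: eq_bigr => z /kidsP[zz zx]; rewrite -sum1_card; apply: eq_bigl => y.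
  rewrite !inE zz; have [e|] := eqVneq (r h y) z; last by rewrite andbF.
  by rewrite andbT -zx -e nested_step eqxx.
have modsum (I : finType) (Q : pred I) (F G : I -> nat) :
    (forall i, Q i -> F i = G i %[mod M]) ->
    \sum_(i | Q i) F i = \sum_(i | Q i) G i %[mod M].
  move=> FG; apply: (big_ind2 (fun a b => a = b %[mod M])) => // a a' b b' ea eb.
  by rewrite -modnDml ea modnDml -modnDmr eb modnDmr.
rewrite (modsum _ _ _ (fun z => type_size P (tp t c h z))); last by move=> z _; apply: IH.
rewrite (partition_big (tp t c h) xpredT) //=; apply: modsum => u _.
rewrite tpS -[RHS]modnMml red_mod // modnMml /cnt -sum_nat_const.
congr (_ %% _).
rewrite [RHS](eq_bigl (fun z => (z \in kids h x) && (tp t c h z == u))); last first.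
  by move=> z; rewrite inE.
by apply: eq_bigr => z /andP[_ /eqP->].
Qed.

Lemma tp_kid (C : finType) (c c' : X -> C) h x x' z : 0 < t ->
  tp t c h.+1 x = tp t c' h.+1 x' -> z \in kids h x ->
  exists2 z', z' \in kids h x' & tp t c h z = tp t c' h z'.
Proof.
move=> t0 /tpS_eq/(_ (tp t c h z)) e zx.
have: 0 < cnt c' x' (tp t c h z).
  by apply: (red_geq M_gt0 e t0); apply/card_gt0P; exists z; rewrite inE zx eqxx.
by case/card_gt0P => z'; rewrite inE => /andP[? /eqP ?]; exists z'.
Qed.

Lemma tp_elt (C : finType) (c c' : X -> C) h x x' y : 0 < t ->
  tp t c h x = tp t c' h x' -> r h y = r h x ->
  exists2 y', r h y' = r h x' & c y = c' y'.
Proof.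
move=> t0; elim: h x x' => [|h IH] x x' e yx.
  have: c y \in tp t c 0 x by apply/imsetP; exists y; rewrite ?inE ?yx.
  by rewrite e => /imsetP[y']; rewrite inE => /eqP ? ?; exists y'.
have [z' /kidsP[_ z'x] e'] := tp_kid t0 e (rep_kids yx).
have [|y' y'z ?] := IH _ _ e'; first by rewrite nested_idem.
by exists y' => //; rewrite (nested_succ y'z).
Qed.

(** The induction descends while the points share a sub-block. If they lie in different sub-blocks
    of equal type, a threshold of at least 2 guarantees two different ones on the other side. *)
Lemma tp_pair (C : finType) (c c' : X -> C) h x x' y1 y2 : 1 < t ->
  tp t c h x = tp t c' h x' -> r h y1 = r h x -> r h y2 = r h x ->
  exists y1' y2', [/\ r h y1' = r h x', r h y2' = r h x', c y1 = c' y1', c y2 = c' y2'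
    & forall l, l <= h -> (r l y1 == r l y2) = (r l y1' == r l y2')].
Proof.
move=> t1; have t0 := ltnW t1; elim: h x x' => [|h IH] x x' e yx1 yx2.
  have [y1' y1x ?] := tp_elt t0 e yx1; have [y2' y2x ?] := tp_elt t0 e yx2.
  exists y1', y2'; split=> // l; rewrite leqn0 => /eqP->.
  by rewrite yx1 yx2 y1x y2x !eqxx.
have [y12|ny12] := eqVneq (r h y1) (r h y2).
  have [z' /kidsP[_ z'x] e'] := tp_kid t0 e (rep_kids yx1).
  have [||y1' [y2' [e1 e2 ? ? lev]]] := IH _ _ e'; rewrite ?nested_idem //.
  exists y1', y2'; split; rewrite ?(nested_succ e1) ?(nested_succ e2) //.
  move=> l; rewrite leq_eqVlt ltnS => /predU1P[->|/lev//].
  by rewrite yx1 yx2 (nested_succ e1) (nested_succ e2) !eqxx.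
set z1 := r h y1 in ny12; set z2 := r h y2 in ny12.
have k1 : z1 \in kids h x by apply: rep_kids.
have k2 : z2 \in kids h x by apply: rep_kids.
have [z1' [z2' [k1' k2' e1 e2 ne]]] : exists z1' z2',
    [/\ z1' \in kids h x', z2' \in kids h x', tp t c h z1 = tp t c' h z1',
        tp t c h z2 = tp t c' h z2' & z1' != z2'].
  have [e12|ne12] := eqVneq (tp t c h z1) (tp t c h z2); last first.
    have [z1' ? e1] := tp_kid t0 e k1; have [z2' ? e2] := tp_kid t0 e k2.
    exists z1', z2'; split=> //; apply: contra ne12 => /eqP e12.
    by rewrite e1 e2 e12.
  have: 1 < cnt c' x' (tp t c h z1).
    move/tpS_eq/(_ (tp t c h z1)): e => e; apply: (red_geq M_gt0 e t1).
    by apply/card_gt1P; exists z1, z2; split; rewrite // inE ?k1 ?k2 -?e12 eqxx.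
  case/card_gt1P => z1' [z2' []]; rewrite inE [in X in _ -> X -> _]inE => /andP[k1' /eqP e1] /andP[k2' /eqP e2] ne.
  by exists z1', z2'; split; rewrite -?e12.
have [|y1' f1 ?] := tp_elt t0 e1 (y := y1); first by rewrite nested_idem.
have [|y2' f2 ?] := tp_elt t0 e2 (y := y2); first by rewrite nested_idem.
move: k1' k2' => /kidsP[r1 s1] /kidsP[r2 s2].
exists y1', y2'; split; rewrite ?(nested_succ f1) ?(nested_succ f2) //.
move=> l; rewrite leq_eqVlt ltnS => /predU1P[->|lel].
  by rewrite yx1 yx2 (nested_succ f1) (nested_succ f2) s1 s2 !eqxx.
rewrite (negbTE (contraNneq _ ny12)); last by move/(nested_le lel) => e12; apply/eqP.
rewrite (negbTE (contraNneq _ ne)) // => /(nested_le lel).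
by rewrite f1 f2 r1 r2 => ->.
Qed.

End Fixed.

(* Back-and-forth: a threshold [T] exceeding [(t + M)] times the number of
   refined types leaves room to redistribute the refined multiplicities. *)
Lemma tp_refine t T (C C2 : finType) h (c c' : X -> C) x x' (f : X -> C2) :
  0 < t -> 0 < T -> (forall l, l < h -> #|block_type M t (C * C2)%type l| * (t + M) < T) ->
  bag_injective c ->
  tp T c h x = tp T c' h x' ->
  exists f' : X -> C2,
    tp t (fun y => (c y, f y)) h x = tp t (fun y => (c' y, f' y)) h x'.
Proof.
move=> t0 T0 leT cinj; elim: h leT x x' => [|h IH] leT x x' e.
  (* In a bag, [y'] copies the value of [f] at the element of the same colour, unique by bag
     injectivity; elsewhere [f x] is a dummy. *)
  have inv y' : exists k, r 0 y' = r 0 x' ->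
      exists2 y, r 0 y = r 0 x & c y = c' y' /\ f y = k.
    have [y'x|ne] := eqVneq (r 0 y') (r 0 x'); last first.
      by exists (f x) => e'; rewrite e' eqxx in ne.
    by have [y yx cy] := tp_elt T0 (esym e) y'x; exists (f y) => _; exists y.
  have [f' f'P] := fin_all_exists inv.
  exists f'; apply/setP => -[k b]; apply/imsetP/imsetP => -[y]; rewrite inE => /eqP yx ->.
    have [y' y'x cy] := tp_elt T0 e yx; exists y'; rewrite ?inE ?y'x //.
    have [z zx [cz fz]] := f'P y' y'x; congr pair => //.
    by rewrite -fz; congr f; apply: cinj; rewrite ?yx ?zx // cz.
  have [z zx [cz fz]] := f'P y yx; exists z; rewrite ?inE ?zx //.
  by rewrite cz fz.
(* The refined types of the sub-blocks are transported first, as a map on representatives; the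
   induction then realises each by a colouring. *)
have [||g' [g'Z g'E]] := transfer_fibres (Z := kids h x) (Z' := kids h x')
    (p := tp T c h) (p' := tp T c' h)
    (T1 := T) (tp t (fun y => (c y, f y)) h) (tp t (fun y => (c y, f y)) h x) M_gt0 t0.
- exact: leT.
- by move/tpS_eq: e.
have fz z' : exists fz : X -> C2, z' \in kids h x' ->
    g' z' = tp t (fun y => (c' y, fz y)) h z'.
  have [/g'Z[z [zx ez <-]]|_] := boolP (z' \in kids h x'); last by exists f.
  have [|fz fzE] := IH _ _ _ ez; first by move=> l /ltnW; apply: leT.
  by exists fz.
have [F FE] := fin_all_exists fz.
(* Gluing: [y] uses the colouring chosen for its own sub-block. *)
exists (fun y => F (r h y) y); apply/tpS_eq => u; rewrite [LHS]g'E; congr red.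
apply: eq_card => z'; rewrite inE [in RHS]inE; have [k'|//] := boolP (z' \in kids h x').
rewrite FE //; congr (_ == _); apply: tp_ext => y ->.
by case/kidsP: k' => ->.
Qed.

End Types.

(** * Types determine formulas *)

Section Formulas.

Variables (U B : Type) (C0 : finType) (D : nat).

Definition hier_structure (A : structure U B) (r : nat -> A -> A) (c0 : A -> C0) :=
  [/\ nested r, forall x y, r D x = r D y, bag_injective r c0,
      forall P x y, c0 x = c0 y -> un P x = un P y
    & forall R x y x' y', c0 x = c0 x' -> c0 y = c0 y' ->
        (forall l, l <= D -> (r l x == r l y) = (r l x' == r l y')) ->
        bi R x y = bi R x' y'].

Definition colour n s : finType := (C0 * {ffun 'I_n -> bool} * {ffun 'I_s -> bool})%type.

Definition env_colour (A : finType) (c0 : A -> C0) n s (e : 'I_n -> A)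
    (E : 'I_s -> {set A}) (x : A) : colour n s :=
  (c0 x, [ffun i => e i == x], [ffun j => x \in E j]).

(** Both assignments live in one structure, which suffices for comparing pairs of its elements; [M]
    and [t] are fixed before the structure and so serve all structures at once. *)
Definition determined M t n s (phi : cmso U B n s) :=
  forall (A : structure U B) (r : nat -> A -> A) (c0 : A -> C0),
  hier_structure r c0 -> forall e e' E E' x x',
  tp r M t (env_colour c0 e E) D x = tp r M t (env_colour c0 e' E') D x' ->
  eval phi e E = eval phi e' E'.

Lemma vcons0 (T : Type) n (x : T) (f : 'I_n -> T) : vcons x f ord0 = x.
Proof. by rewrite /vcons unlift_none. Qed.

Lemma vconsS (T : Type) n (x : T) (f : 'I_n -> T) i : vcons x f (lift ord0 i) = f i.
Proof. by rewrite /vcons liftK. Qed.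

Section Structure.

Variables (M : nat) (M_gt0 : 0 < M).
Variables (A : structure U B) (r : nat -> A -> A) (c0 : A -> C0).
Hypothesis hA : hier_structure r c0.

Lemma hier_nested : nested r. Proof. by case: hA. Qed.
Lemma hier_top x y : r D x = r D y. Proof. by case: hA. Qed.
Lemma hier_bag : bag_injective r c0. Proof. by case: hA. Qed.

Lemma env_colour_bag n s (e : 'I_n -> A) (E : 'I_s -> {set A}) :
  bag_injective r (env_colour c0 e E).
Proof. by move=> x y rxy [cxy _ _]; apply: hier_bag. Qed.

(** The elements given by [tp_pair] carry the marks of [i] and [j], and a mark sits on one element
    only, so they are [e' i] and [e' j]. *)
Lemma env_pair t n s (e e' : 'I_n -> A) (E E' : 'I_s -> {set A}) x x' i j : 1 < t ->
  tp r M t (env_colour c0 e E) D x = tp r M t (env_colour c0 e' E') D x' ->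
  [/\ env_colour c0 e E (e i) = env_colour c0 e' E' (e' i),
      env_colour c0 e E (e j) = env_colour c0 e' E' (e' j)
    & forall l, l <= D -> (r l (e i) == r l (e j)) = (r l (e' i) == r l (e' j))].
Proof.
move=> t1 eq_tp.
have [y1 [y2 [_ _ e1 e2 lev]]] :=
  tp_pair hier_nested M_gt0 t1 eq_tp (hier_top (e i) x) (hier_top (e j) x).
have mark i' y : env_colour c0 e E (e i') = env_colour c0 e' E' y -> y = e' i'.
  by case=> _ /ffunP/(_ i'); rewrite !ffunE eqxx => /esym/eqP.
by rewrite -(mark i y1 e1) -(mark j y2 e2).
Qed.

Definition push_elt n s (k : colour n s * bool) : colour n.+1 s :=
  (k.1.1.1, [ffun i => vcons k.2 k.1.1.2 i], k.1.2).

Definition push_set n s (k : colour n s * bool) : colour n s.+1 :=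
  (k.1.1, [ffun j => vcons k.2 k.1.2 j]).

Lemma push_eltE n s (e : 'I_n -> A) (E : 'I_s -> {set A}) x y :
  env_colour c0 (vcons x e) E y = push_elt (env_colour c0 e E y, x == y).
Proof.
congr (_, _, _); apply/ffunP => i; rewrite !ffunE.
by case: (unliftP ord0 i) => [j|] ->; rewrite ?vcons0 // !vconsS ffunE.
Qed.

Lemma push_setE n s (e : 'I_n -> A) (E : 'I_s -> {set A}) Y y :
  env_colour c0 e (vcons Y E) y = push_set (env_colour c0 e E y, y \in Y).
Proof.
congr (_, _, _); apply/ffunP => i; rewrite !ffunE.
by case: (unliftP ord0 i) => [j|] ->; rewrite ?vcons0 // !vconsS ffunE.
Qed.

Section Forth.

Variables (t T n s : nat).
Hypotheses (t_gt1 : 1 < t) (T_gt0 : 0 < T).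
Hypothesis T_large : forall l, l < D ->
  #|block_type M t (colour n s * bool)%type l| * (t + M) < T.
Variables (e e' : 'I_n -> A) (E E' : 'I_s -> {set A}) (x x' : A).
Hypothesis eq_tp : tp r M T (env_colour c0 e E) D x = tp r M T (env_colour c0 e' E') D x'.

Lemma forth_set Y : exists Y',
  tp r M t (env_colour c0 e (vcons Y E)) D x
  = tp r M t (env_colour c0 e' (vcons Y' E')) D x'.
Proof.
have [f' f'E] := tp_refine hier_nested M_gt0 (fun y => y \in Y) (ltnW t_gt1) T_gt0
  T_large (env_colour_bag (E := E)) eq_tp.
exists [set y | f' y].
apply: (tp_recolour hier_nested M_gt0 (phi := @push_set n s) _ _ f'E) => y /=.
  exact: push_setE.
by rewrite push_setE inE.
Qed.

(** Refining by the indicator of [y] yields a set on the other side. It is a singleton: by [tp_pair]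
    read backwards, two of its elements would both match [y], hence share a bag and a colour. *)
Lemma forth_elt y : exists y',
  tp r M t (env_colour c0 (vcons y e) E) D x
  = tp r M t (env_colour c0 (vcons y' e') E') D x'.
Proof.
have [f' f'E] := tp_refine hier_nested M_gt0 (fun z => y == z) (ltnW t_gt1) T_gt0
  T_large (env_colour_bag (E := E)) eq_tp.
have [y' _ [_ _ _ fy']] := tp_elt hier_nested M_gt0 (ltnW t_gt1) f'E (hier_top y x).
have f'1 z : f' z = (y' == z).
  apply/idP/eqP => [fz|<-]; last by rewrite -fy' eqxx.
  have [y1 [y2 [_ _]]] := tp_pair hier_nested M_gt0 t_gt1 (esym f'E)
    (hier_top y' x') (hier_top z x').
  move=> -[c1 _ _ f1] [c2 _ _ f2] lev; move: f1 f2 lev; rewrite -fy' eqxx fz.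
  move=> /esym/eqP ? /esym/eqP ?; subst y1 y2 => /(_ 0 isT).
  by rewrite eqxx => /eqP; move/hier_bag; apply; rewrite c1 c2.
exists y'; apply: (tp_recolour hier_nested M_gt0 (phi := @push_elt n s) _ _ f'E) => z /=.
  exact: push_eltE.
by rewrite push_eltE f'1.
Qed.

End Forth.
End Structure.

(** * Modulus and threshold for a formula *)

Lemma refinement_threshold (M t : nat) (C : finType) : exists2 T, 0 < T &
  forall T', T <= T' -> forall l, l < D -> #|block_type M t C l| * (t + M) < T'.
Proof.
exists (\sum_(l < D) #|block_type M t C l| * (t + M)).+1 => // T' leT l ltl.
apply: leq_trans leT; rewrite ltnS.
by rewrite (bigD1 (Ordinal ltl)) //= leq_addr.
Qed.

(** The modulus comes first, as any positive multiple of [M0], so that subformulas can share it. The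
    threshold comes second: what a quantifier costs depends on the number of types, hence on [M]. *)
Definition eventually_determined n s (phi : cmso U B n s) :=
  exists2 M0, 0 < M0 & forall M, 0 < M -> M0 %| M ->
  exists t0, forall t, t0 <= t -> determined M t phi.

Lemma atom_determined n s (phi : cmso U B n s) :
  (forall M t, 0 < M -> 1 < t -> determined M t phi) -> eventually_determined phi.
Proof. by move=> det; exists 1 => // M M0 _; exists 2 => t t1; apply: det. Qed.

Lemma quant_determined n s n' s' (f : cmso U B n' s') (phi : cmso U B n s) :
  eventually_determined f ->
  (forall M t T, 0 < M -> 1 < t -> 0 < T ->
     (forall l, l < D -> #|block_type M t (colour n s * bool)%type l| * (t + M) < T) ->
     determined M t f -> determined M T phi) ->
  eventually_determined phi.
Proof.
move=> [M0 M0_gt0 detf] quant; exists M0 => // M M_gt0 dvdM.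
have [t0 {}detf] := detf M M_gt0 dvdM.
(* The threshold for the body is raised to at least 2, as [tp_pair] demands. *)
have [T T_gt0 largeT] := refinement_threshold M (maxn 2 t0) (colour n s * bool)%type.
exists T => t leT; apply: (quant M (maxn 2 t0)) => //.
- exact: leq_maxl.
- exact: leq_trans leT.
- exact: largeT.
- by apply: detf; apply: leq_maxr.
Qed.

Lemma binary_determined n s (f g phi : cmso U B n s) (op : bool -> bool -> bool) :
  eventually_determined f -> eventually_determined g ->
  (forall (A : structure U B) (e : 'I_n -> A) E,
     eval phi e E = op (eval f e E) (eval g e E)) ->
  eventually_determined phi.
Proof.
move=> [M1 M1_gt0 det1] [M2 M2_gt0 det2] phiE.
exists (M1 * M2) => [|M M_gt0 dvdM]; first by rewrite muln_gt0 M1_gt0.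
have [t1 {}det1] := det1 M M_gt0 (dvdn_trans (dvdn_mulr _ (dvdnn _)) dvdM).
have [t2 {}det2] := det2 M M_gt0 (dvdn_trans (dvdn_mull _ (dvdnn _)) dvdM).
exists (maxn t1 t2) => t; rewrite geq_max => /andP[le1 le2] A r c0 hA e e' E E' x x' e_tp.
by rewrite !phiE (det1 _ le1 A r c0 hA _ _ _ _ _ _ e_tp) (det2 _ le2 A r c0 hA _ _ _ _ _ _ e_tp).
Qed.

Lemma eval_determined n s (phi : cmso U B n s) : eventually_determined phi.
Proof.
elim: phi => {n s}.
- move=> n s i j; apply: atom_determined => M t M0 t1 A r c0 hA e e' E E' x x' e_tp /=.
  have [[_ /ffunP/(_ j)]] := env_pair M0 hA i j t1 e_tp.
  by rewrite !ffunE [_ == e i]eq_sym [_ == e' i]eq_sym.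
- move=> n s i j; apply: atom_determined => M t M0 t1 A r c0 hA e e' E E' x x' e_tp /=.
  have [[_ _ /ffunP/(_ j)]] := env_pair M0 hA i i t1 e_tp.
  by rewrite !ffunE.
- move=> n s P i; apply: atom_determined => M t M0 t1 A r c0 hA e e' E E' x x' e_tp /=.
  have [[c _ _] _ _] := env_pair M0 hA i i t1 e_tp.
  by case: hA => _ _ _ /(_ _ _ _ c).
- move=> n s R i j; apply: atom_determined => M t M0 t1 A r c0 hA e e' E E' x x' e_tp /=.
  have [[ci _ _] [cj _ _] lev] := env_pair M0 hA i j t1 e_tp.
  by case: hA => _ _ _ _; apply.
(* [b] is positive since ['I_b] contains [a]. Sizes modulo [M] are visible at every threshold, hence
   0. *)
- move=> n s b a j; exists b; first by case: b a => // -[].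
  move=> M M0 dvdM; exists 0 => t _ A r c0 hA e e' E E' x x' e_tp /=.
  have szE (e1 : 'I_n -> A) (E1 : 'I_s -> {set A}) y : #|E1 j| = type_size (fun k : colour n s => k.2 j)
      (tp r M t (env_colour c0 e1 E1) D y) %[mod M].
    rewrite -(type_sizeE (hier_nested hA) M0 _ _ _ _ (env_colour_bag hA (e := e1) (E := E1))).
    congr (_ %% _); apply: eq_card => z; rewrite inE (hier_top hA z y) eqxx /=.
    by rewrite ffunE.
  have : #|E j| = #|E' j| %[mod M] by rewrite (szE e E x) e_tp -szE.
  by move=> eqM; rewrite -(modn_dvdm _ dvdM) eqM modn_dvdm.
- move=> n s f [M0 M0_gt0 det]; exists M0 => // M M_gt0 dvdM.
  have [t0 {}det] := det M M_gt0 dvdM; exists t0 => t le A r c0 hA e e' E E' x x' e_tp /=.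
  by rewrite (det t le A r c0 hA _ _ _ _ _ _ e_tp).
- by move=> n s f IHf g IHg; apply: (binary_determined (op := andb) IHf IHg).
- by move=> n s f IHf g IHg; apply: (binary_determined (op := orb) IHf IHg).
- move=> n s f IH; apply: (quant_determined IH) => M t T M0 t1 T0 largeT det.
  move=> A r c0 hA e e' E E' x x' e_tp /=.
  apply/existsP/existsP => -[y fy].
    have [y' e_y] := forth_elt M0 hA t1 T0 largeT e_tp y.
    by exists y'; rewrite -(det A r c0 hA _ _ _ _ _ _ e_y).
  have [y' e_y] := forth_elt M0 hA t1 T0 largeT (esym e_tp) y.
  by exists y'; rewrite -(det A r c0 hA _ _ _ _ _ _ e_y).
- move=> n s f IH; apply: (quant_determined IH) => M t T M0 t1 T0 largeT det.
  move=> A r c0 hA e e' E E' x x' e_tp /=.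
  apply/forallP/forallP => fy y.
    have [y' e_y] := forth_elt M0 hA t1 T0 largeT (esym e_tp) y.
    by rewrite (det A r c0 hA _ _ _ _ _ _ e_y).
  have [y' e_y] := forth_elt M0 hA t1 T0 largeT e_tp y.
  by rewrite (det A r c0 hA _ _ _ _ _ _ e_y).
- move=> n s f IH; apply: (quant_determined IH) => M t T M0 t1 T0 largeT det.
  move=> A r c0 hA e e' E E' x x' e_tp /=.
  apply/existsP/existsP => -[y fy].
    have [y' e_y] := forth_set M0 hA t1 T0 largeT e_tp y.
    by exists y'; rewrite -(det A r c0 hA _ _ _ _ _ _ e_y).
  have [y' e_y] := forth_set M0 hA t1 T0 largeT (esym e_tp) y.
  by exists y'; rewrite -(det A r c0 hA _ _ _ _ _ _ e_y).
- move=> n s f IH; apply: (quant_determined IH) => M t T M0 t1 T0 largeT det.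
  move=> A r c0 hA e e' E E' x x' e_tp /=.
  apply/forallP/forallP => fy y.
    have [y' e_y] := forth_set M0 hA t1 T0 largeT (esym e_tp) y.
    by rewrite (det A r c0 hA _ _ _ _ _ _ e_y).
  have [y' e_y] := forth_set M0 hA t1 T0 largeT e_tp y.
  by rewrite (det A r c0 hA _ _ _ _ _ _ e_y).
Qed.

End Formulas.

(** * Marking two elements *)

Section Marking.

Variables (X : finType) (r : nat -> X -> X).
Hypothesis r_nested : nested r.
Variables (M : nat) (M_gt0 : 0 < M) (t : nat).

(** Recolouring inside the single sub-block [z] moves one unit from its old type to its new one; the
    additive form avoids subtraction. *)
Lemma cnt_replace (C : finType) (c c' : X -> C) h x z (u : block_type M t C h) :
  z \in kids r h x -> (forall w, r h w <> z -> c' w = c w) ->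
  cnt r c' x u + (tp r M t c h z == u) = cnt r c x u + (tp r M t c' h z == u).
Proof.
move=> kz cc'.
have memE (d : X -> C) : (z \in [set w in kids r h x | tp r M t d h w == u])
    = (tp r M t d h z == u) by rewrite inE kz.
rewrite /cnt (cardsD1 z) [in RHS](cardsD1 z) !memE addnAC [in RHS]addnAC.
rewrite [X in X + _ = _]addnC; congr (_ + _).
apply: eq_card => w; rewrite !inE; have [//|nwz] := eqVneq w z.
have [/eqP rw|//] := boolP (r h w == w); congr (_ && (_ == _)).
apply: tp_ext => // y ry; apply: cc' => ryz.
by move/eqP: nwz; apply; rewrite -rw -ry.
Qed.

Lemma cnt_exchange T (C : finType) (c c' d d' : X -> C) h x y z w
    (u : block_type M t C h) :
  z \in kids r h x -> w \in kids r h y ->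
  (forall v, r h v <> z -> c' v = c v) -> (forall v, r h v <> w -> d' v = d v) ->
  tp r M t c h z = tp r M t d h w -> tp r M t c' h z = tp r M t d' h w ->
  red M T.+1 (cnt r c x u) = red M T.+1 (cnt r d y u) ->
  red M T (cnt r c' x u) = red M T (cnt r d' y u).
Proof.
move=> kz kw cc' dd' ez ew e.
apply: (red_exchange M_gt0 e (cnt_replace u kz cc')).
by rewrite ez ew; apply: cnt_replace.
Qed.

Variables (C0 : finType) (c0 : X -> C0).
Hypothesis c0_bag : bag_injective r c0.

Let BT := block_type M t (C0 * bool * bool)%type.

Definition marked (p q : pred X) (w : X) : C0 * bool * bool := (c0 w, p w, q w).

Definition unmarked := marked xpred0 xpred0.

Fixpoint signature_type h : finType :=
  if h is h'.+1 then
    (signature_type h' * (BT h' * BT h' * BT h') * {ffun BT h' -> 'I_(t.+2 + M).+1})%type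
  else (C0 * BT 0)%type.

(* Unmarked multiplicities are kept with two more units of threshold than the
   types, because marking two elements displaces two sub-blocks. *)
Fixpoint signature h (x : X) : signature_type h :=
  if h is h'.+1 return signature_type h then
    (signature h' x,
     (tp r M t unmarked h' x, tp r M t (marked (eq_op x) xpred0) h' x,
      tp r M t (marked xpred0 (eq_op x)) h' x),
     [ffun u => inord (red M t.+2 (cnt r unmarked x u))])
  else (c0 x, tp r M t unmarked 0 x).

Lemma signatureS h x y : signature h.+1 x = signature h.+1 y ->
  [/\ signature h x = signature h y,
      tp r M t unmarked h x = tp r M t unmarked h y,
      tp r M t (marked (eq_op x) xpred0) h x = tp r M t (marked (eq_op y) xpred0) h y,
      tp r M t (marked xpred0 (eq_op x)) h x = tp r M t (marked xpred0 (eq_op y)) h y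
    & forall u : BT h, red M t.+2 (cnt r unmarked x u) = red M t.+2 (cnt r unmarked y u)].
Proof.
case=> es e1 e2 e3 /ffunP ec; split=> // u.
move: (ec u); rewrite !ffunE => /(congr1 val) /=.
by rewrite !inordK // ltnW // ltnS red_lt.
Qed.

Lemma signature_colour h x y : signature h x = signature h y -> c0 x = c0 y.
Proof. by elim: h => [[]|h IH /signatureS[/IH]]. Qed.

(** Marking affects only the sub-blocks of [x] and [y]. If they coincide, the induction gives the
    marked type; otherwise the singly marked types stored in the signatures are inserted one after
    the other. *)
Lemma marked_pair h x y x' y' :
  signature h x = signature h x' -> signature h y = signature h y' ->
  r h x = r h y -> r h x' = r h y' ->
  (forall l, l <= h -> (r l x == r l y) = (r l x' == r l y')) ->
  tp r M t (marked (eq_op x) (eq_op y)) h x = tp r M t (marked (eq_op x') (eq_op y')) h x'.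
Proof.
elim: h => [|h IH] sx sy rxy rxy' lev.
  have [cx cy] := (signature_colour sx, signature_colour sy).
  (* In a bag, comparing colours recovers the marks, as [c0] is injective there. *)
  have bagE a b : r 0 a = r 0 b ->
      tp r M t (marked (eq_op a) (eq_op b)) 0 a =
      [set (k.1.1, c0 a == k.1.1, c0 b == k.1.1) | k in (tp r M t unmarked 0 a : {set _})].
    move=> rab; rewrite /= -imset_comp; apply: eq_in_imset => w; rewrite inE => /eqP rw.
    congr (_, _, _); apply/eqP/eqP => [->//|]; apply: c0_bag => //.
    by rewrite rw.
  have e0 : tp r M t unmarked 0 x = tp r M t unmarked 0 x' by case: sx.
  by rewrite !bagE // cx cy e0.
have [{}sx tx tx1 _ ecnt] := signatureS sx; have [{}sy ty _ ty2 _] := signatureS sy.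
have lev' l : l <= h -> (r l x == r l y) = (r l x' == r l y') by move/leqW/lev.
have nested_block (c : X -> C0 * bool * bool) z : tp r M t c h (r h z) = tp r M t c h z.
  by apply: tp_block => //; rewrite nested_idem.
have off a w : r h w <> r h a -> (a == w) = false by move=> ne; apply/eqP => e; apply: ne; rewrite e.
apply/tpS_eq => // u.
have kx : r h x \in kids r h x by apply: rep_kids.
have kx' : r h x' \in kids r h x' by apply: rep_kids.
have [hxy|nhxy] := eqVneq (r h x) (r h y).
  have /eqP hxy' : r h x' == r h y' by rewrite -lev' // hxy.
  apply: (cnt_exchange kx kx' _ _ _ _ (_ : red M t.+1 (cnt r unmarked x u) = _)).
  - by move=> v ne; rewrite /unmarked /marked !off // -hxy.
  - by move=> v ne; rewrite /unmarked /marked !off // -hxy'.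
  - by rewrite !nested_block.
  - by rewrite !nested_block IH.
  (* A trivial exchange, lowering the threshold from [t.+2] to [t.+1]: only one sub-block is
     replaced in this case. *)
  - apply: (@red_exchange _ M_gt0 _ _ _ _ _ false false (ecnt u)) => //.
have nhxy' : r h x' != r h y' by rewrite -lev'.
have ky : r h y \in kids r h x by apply: rep_kids.
have ky' : r h y' \in kids r h x' by apply: rep_kids.
have xy w : r h w = r h y -> (x == w) = false by move=> e; rewrite off // e; apply/eqP; rewrite eq_sym.
have xy' w : r h w = r h y' -> (x' == w) = false by move=> e; rewrite off // e; apply/eqP; rewrite eq_sym.
pose c1 := marked (eq_op x) xpred0; pose c1' := marked (eq_op x') xpred0.
(* First [x] is marked, then [y]; the sub-block of [y] avoids [x], so it is still unmarked at the
   second replacement. *)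
have e1 : red M t.+1 (cnt r c1 x u) = red M t.+1 (cnt r c1' x' u).
  apply: (cnt_exchange kx kx' _ _ _ _ (ecnt u)).
  - by move=> v ne; rewrite /unmarked /c1 /marked off.
  - by move=> v ne; rewrite /unmarked /c1' /marked off.
  - by rewrite !nested_block.
  - by rewrite !nested_block.
apply: (cnt_exchange ky ky' _ _ _ _ e1).
- by move=> v ne; rewrite /c1 /marked [y == v]off.
- by move=> v ne; rewrite /c1' /marked [y' == v]off.
- rewrite !nested_block (@tp_ext _ _ _ _ M_gt0 _ _ _ unmarked) //; last first.
    by move=> w e; rewrite /c1 /marked xy.
  rewrite ty; apply: tp_ext => // w e; rewrite /c1' /marked xy' //.
- rewrite !nested_block (@tp_ext _ _ _ _ M_gt0 _ _ _ (marked xpred0 (eq_op y))) //; last first.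
    by move=> w e; rewrite /marked xy.
  rewrite ty2; apply: tp_ext => // w e; rewrite /marked xy' //.
Qed.

End Marking.

(** The type of the whole structure with [x] and [y] marked decides [mu], and signatures with shared
    levels determine that type. [F] precedes the structure, so the number of colours is bounded
    uniformly. *)
Lemma binary_query_signature (U B : Type) (C0 : finType) D (mu : cmso U B 2 0) :
  exists F : finType, forall (A : structure U B) (r : nat -> A -> A) (c0 : A -> C0),
  hier_structure D r c0 -> exists sg : A -> F, forall x y x' y',
  sg x = sg x' -> sg y = sg y' ->
  (forall l, l <= D -> (r l x == r l y) = (r l x' == r l y')) ->
  holds2 mu x y = holds2 mu x' y'.
Proof.
have [M M_gt0 /(_ M M_gt0 (dvdnn M))[t /(_ t (leqnn t)) det]] := eval_determined C0 D mu.
exists (signature_type M t C0 D) => A r c0 hA.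
have rn := hier_nested hA.
exists (signature r M t c0 D) => x y x' y' sx sy lev.
have top := hier_top hA.
have := marked_pair rn M_gt0 (hier_bag hA) sx sy (top x y) (top x' y') lev.
pose phi (k : C0 * bool * bool) : colour C0 2 0 :=
  (k.1.1, [ffun i => vcons k.1.2 (vcons k.2 vnil) i], [ffun _ => false]).
have phiE a b : env_colour c0 (vcons a (vcons b vnil)) vnil
    =1 phi \o marked c0 (eq_op a) (eq_op b).
  move=> w; congr (_, _, _); apply/ffunP; last by case.
  move=> i; rewrite !ffunE /=.
  case: (unliftP ord0 i) => [j|] ->; rewrite ?vcons0 // !vconsS.
  by case: (unliftP ord0 j) => [[]|] // ->; rewrite ?vcons0.
by move/(tp_recolour rn M_gt0 (phiE x y) (phiE x' y')) => /(det A r c0 hA).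
Qed.

(** * Copied tree-models as nested partitions *)

Section TreeDistance.

Variable T : rtree.
Implicit Types x y z r : T.

Definition up n x : option T := iter n (obind (@parent T)) (Some x).

Lemma upD m n x : up (m + n) x = obind (up m) (up n x).
Proof.
rewrite /up iterD; case: (iter n _ _) => //=.
by elim: m => //= m ->.
Qed.

Lemma up_root n r : parent r = None -> up n.+1 r = None.
Proof. by move=> pr; rewrite -addn1 upD /= pr. Qed.

Lemma up_rootE n m x r : up n x = Some r -> parent r = None ->
  (m <= n) = (up m x != None).
Proof.
move=> ux pr; case: leqP => [le|lt]; apply/esym.
  by move: ux; rewrite -(subnK le) upD; case: (up m x).
rewrite -(subnK lt) -addSnnS upD ux; apply/negbTE; rewrite negbK; apply/eqP.
exact: up_root.
Qed.

Lemma up_root_inj n m x r s : up n x = Some r -> parent r = None ->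
  up m x = Some s -> parent s = None -> n = m.
Proof.
move=> ur pr us ps; apply/eqP.
by rewrite eqn_leq (up_rootE _ us ps) (up_rootE _ ur pr) ur us.
Qed.

Lemma connect_up x y : connect (@child T) x y <-> exists n, up n y = Some x.
Proof.
split=> [/connectP[p]|[n]].
  elim: p x => [|z p IH] x /= => [_ ->|/andP[/eqP xz pz] lz]; first by exists 0.
  by have [n uz] := IH z pz lz; exists n.+1; rewrite -add1n upD uz.
elim: n x => [|n IH] x; first by case=> ->.
rewrite -add1n upD; case uz: (up n y) => [z|] //= pz.
by apply: connect_trans (IH z uz); apply: connect1; apply/eqP.
Qed.

Lemma up_path n x z : up n x = Some z ->
  (exists p, [/\ path (@tadj T) x p, last x p = z & size p = n]) /\
  (exists p, [/\ path (@tadj T) z p, last z p = x & size p = n]).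
Proof.
elim: n z => [|n IH] z; first by case=> ->; split; exists [::].
rewrite -add1n upD; case uy: (up n x) => [y|] //= pz.
have [[p [pp lp sp]] [q [pq lq sq]]] := IH y uy; split.
  exists (rcons p z); rewrite rcons_path last_rcons size_rcons pp lp sp.
  by split=> //; rewrite /tadj /child pz eqxx orbT.
by exists (y :: q); rewrite /= pq lq sq /tadj /child pz eqxx.
Qed.

(* [z] is the topmost node of the path. *)
Lemma path_meet x p : path (@tadj T) x p ->
  exists i j z, [/\ i + j <= size p, up i x = Some z & up j (last x p) = Some z].
Proof.
elim/last_ind: p => [|p w IH] /=; first by exists 0, 0, x.
rewrite rcons_path last_rcons size_rcons => /andP[/IH[i [j [z [le ux uy]]]] adj].
case/orP: adj => [/eqP pw|/eqP py].
  exists i, j.+1, z; split=> //; first by rewrite addnS.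
  by rewrite -addn1 upD /= pw.
case: j uy le => [[ey] le|j uy le].
  exists i.+1, 0, w; split=> //.
  by rewrite -add1n upD ux /= -ey.
exists i, j, z; split=> //; first by lia.
by move: uy; rewrite -addn1 upD /= py.
Qed.

Lemma tdist_uniq x y n m : tdist x y n -> tdist x y m -> n = m.
Proof.
move=> [[p [pp lp sp]] minn] [[q [pq lq sq]] minm]; apply/eqP; rewrite eqn_leq.
by rewrite -{1}sq minn // -sp minm.
Qed.

Lemma tdist_root n x r : up n x = Some r -> parent r = None -> tdist r x n.
Proof.
move=> ux pr; split; first by case: (up_path ux).
move=> p pp lp; have [i [j [z [le ur uy]]]] := path_meet pp.
case: i le ur => [|i] le ur; last by rewrite up_root in ur.
case: ur => ez; rewrite -ez lp in uy.
by rewrite (up_root_inj ux pr uy pr).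
Qed.

(** For the lower bound, [path_meet] gives a common ancestor of both ends; equal depth puts it
    equally far above both, so at least [l] steps. *)
Lemma tdist_meet n l x y z r s : up n x = Some r -> parent r = None ->
  up n y = Some s -> parent s = None ->
  up l x = Some z -> up l y = Some z -> (forall i, i < l -> up i x != up i y) ->
  tdist x y (2 * l).
Proof.
move=> ur pr us ps uxz uyz lmin; split.
  have [[p [pp lp sp]] _] := up_path uxz; have [_ [q [pq lq sq]]] := up_path uyz.
  by exists (p ++ q); rewrite cat_path last_cat size_cat lp pp pq lq sp sq; split=> //; lia.
move=> p pp lp; have [i [j [w [le ux uy]]]] := path_meet pp; rewrite lp in uy.
have rest i' x' r' : up n x' = Some r' -> parent r' = None -> up i' x' = Some w ->
    i' <= n /\ up (n - i') w = Some r'.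
  move=> ux' pr' uw; have le' : i' <= n by rewrite (up_rootE _ ux' pr') uw.
  by split=> //; move: ux'; rewrite -{1}(subnK le') upD uw.
have [lei wi] := rest i x r ur pr ux; have [lej wj] := rest j y s us ps uy.
have ij : i = j by have := up_root_inj wi pr wj ps; lia.
have : ~ i < l by move=> lt; have := lmin i lt; rewrite ux ij uy eqxx.
lia.
Qed.

End TreeDistance.

(* [R h v] plays the role of the ancestor of [v] at height [h.+1]. *)
Definition layered d m k (G : sgraph) : Prop :=
  exists (L : finType) (R : nat -> G -> L) (col : G -> 'I_m),
  [/\ forall h u v, R h u = R h v -> R h.+1 u = R h.+1 v,
      forall u v, R d u = R d v,
      forall v, #|[set u | R 0 u == R 0 v]| <= k
    & forall u v u' v', u != v -> u' != v' -> col u = col u' -> col v = col v' ->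
        (forall h, h <= d -> (R h u == R h v) = (R h u' == R h v')) ->
        edge u v = edge u' v'].

(** Two leaves are at distance twice the height of their first common ancestor, so colours and
    shared levels fix adjacency. A bag lies below one node at distance [d] from the root, whence
    [k]. *)
Lemma TMC_layered d m k G : TMC d m k G -> layered d m k G.
Proof.
case=> Mo small; set T := tm_tree Mo; set lf : G -> T := @tm_leaf _ _ _ Mo.
have leaf v : is_leaf (lf v) by apply/tm_leaf_im; exists v.
have depth v : exists2 r, up d.+1 (lf v) = Some r & parent r = None.
  have [r pr /connect_up[n un]] := root_reach (lf v); exists r => //.
  have /tdist_uniq dn := tdist_root un pr.
  by rewrite -(dn d.+1) //; apply: tm_depth => //; apply/eqP.
exists (option T : finType), (fun h v => up h.+1 (lf v)), (@tm_col _ _ _ Mo); split.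
- by move=> h u v e; rewrite -add1n upD e -upD.
- move=> u v; have [r -> pr] := depth u; have [s -> ps] := depth v.
  by rewrite (root_unique pr ps).
- move=> v; have [r ur pr] := depth v.
  have [b ub bd] : exists2 b, up 1 (lf v) = Some b & up d b = Some r.
    by move: ur; rewrite -addn1 upD; case: (up 1 _) => // b; exists b.
  have rr : is_root r by apply/eqP.
  apply: leq_trans (small r b rr (tdist_root bd pr)).
  rewrite -(card_imset _ (@tm_leaf_inj _ _ _ Mo)); apply: subset_leq_card.
  apply/subsetP => y /imsetP[u]; rewrite inE => /eqP eu ->; rewrite inE leaf /=.
  by apply/connect_up; exists 1; rewrite -ub -eu.
move=> u v u' v' nuv nuv' cu cv lev.
have meet : exists l, up l (lf u) == up l (lf v).
  exists d.+1; have [r -> pr] := depth u; have [s -> ps] := depth v.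
  by rewrite (root_unique pr ps).
have [l elv lmin] := ex_minnP meet.
have l_gt0 : 0 < l.
  case: l elv {lmin} => // /eqP [] /tm_leaf_inj e.
  by rewrite e eqxx in nuv.
have led : l <= d.+1.
  apply: lmin; have [r -> pr] := depth u; have [s -> ps] := depth v.
  by rewrite (root_unique pr ps).
have dist a b : up l (lf a) == up l (lf b) ->
    (forall i, i < l -> up i (lf a) != up i (lf b)) -> tdist (lf a) (lf b) (2 * l).
  move=> /eqP eab min'; have [r ur pr] := depth a; have [s us ps] := depth b.
  have : up l (lf a) != None by rewrite -(up_rootE _ ur pr).
  case ua: (up l (lf a)) => [z|] // _; rewrite ua in eab.
  exact: (tdist_meet ur pr us ps ua (esym eab)).
rewrite (tm_edge nuv (dist u v elv _)); last first.
  by move=> i lt; apply/negP => /lmin; rewrite leqNgt lt.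
rewrite cu cv; apply/esym/tm_edge => //; apply: dist.
  by case: l l_gt0 led elv {lmin} => // l _ led; rewrite lev.
(* At height 0 the leaves differ because the vertices do; [lev] covers heights from 1 on. *)
case=> [|i] lt; first by apply: contra nuv' => /eqP [] /tm_leaf_inj ->.
rewrite -lev; last by lia.
by apply/negP => /lmin; rewrite leqNgt lt.
Qed.

(** * From nested partitions back to a tree *)

Definition rep (X : finType) (L : eqType) (f : X -> L) x := odflt x [pick y | f y == f x].

Lemma repK (X : finType) (L : eqType) (f : X -> L) x : f (rep f x) = f x.
Proof. by rewrite /rep; case: pickP => [y /eqP|] //. Qed.

Lemma rep_eq (X : finType) (L : eqType) (f : X -> L) x y :
  (rep f x == rep f y) = (f x == f y).
Proof.
apply/eqP/eqP => [e|e]; first by rewrite -(repK f x) e repK.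
by rewrite /rep e; case: pickP => // /(_ y); rewrite eqxx.
Qed.

Section LayeredTree.

Variables (d : nat) (X L : finType) (R : nat -> X -> L).
Hypothesis R_step : forall h u v, R h u = R h v -> R h.+1 u = R h.+1 v.
Hypothesis R_top : forall u v, R d u = R d v.

Definition anc h (v : X) : X := if h is h'.+1 then rep (R h') v else v.

Lemma anc_idem h v : anc h (anc h v) = anc h v.
Proof. by case: h => //= h; apply/eqP; rewrite rep_eq repK. Qed.

Lemma anc_step h v : anc h.+1 (anc h v) = anc h.+1 v.
Proof. by case: h => //= h; apply/eqP; rewrite rep_eq (R_step (repK _ _)). Qed.

Lemma anc_top u v : anc d.+1 u = anc d.+1 v.
Proof. by apply/eqP; rewrite /= rep_eq (R_top u v). Qed.

Lemma anc_le h l u v : h <= l -> anc h u = anc h v -> anc l u = anc l v.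
Proof.
move=> le e; rewrite -(subnKC le); elim: (l - h) => [|j IH]; first by rewrite addn0.
by rewrite addnS -anc_step IH anc_step.
Qed.

(** Fixed points of [anc] name each block once. The height tag separates equal blocks of different
    heights, which gives all leaves the same depth. *)
Definition layer_node := {p : 'I_d.+2 * X | anc p.1 p.2 == p.2}.

Lemma mknode_subproof h v : anc (inord h : 'I_d.+2) (anc (inord h : 'I_d.+2) v)
  == anc (inord h : 'I_d.+2) v.
Proof. by rewrite anc_idem. Qed.

Definition mknode h v : layer_node :=
  exist _ (inord h, anc (inord h : 'I_d.+2) v) (mknode_subproof h v).

Lemma mknode_surj (p : layer_node) : exists h v, h <= d.+1 /\ p = mknode h v.
Proof.
case: p => [[h v] hv]; exists h, v; split; first by rewrite -ltnS.
by apply/val_inj; rewrite /= inord_val (eqP hv).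
Qed.

Lemma mknode_inj h l u v : h <= d.+1 -> l <= d.+1 ->
  mknode h u = mknode l v -> h = l /\ anc h u = anc h v.
Proof.
by move=> leh lel /(congr1 val) [/(congr1 val)] /=; rewrite !inordK // => <-.
Qed.

Lemma mknode_eq h u v : h <= d.+1 -> anc h u = anc h v -> mknode h u = mknode h v.
Proof. by move=> le e; apply/val_inj; rewrite /= !inordK // e. Qed.

Definition layer_parent (p : layer_node) : option layer_node :=
  if (val p).1 == d.+1 :> nat then None else Some (mknode (val p).1.+1 (val p).2).

Lemma layer_parent_node h v : h <= d -> layer_parent (mknode h v) = Some (mknode h.+1 v).
Proof.
move=> le; rewrite /layer_parent /= inordK; last by lia.
rewrite eqn_leq [d < h]ltnNge le andbF; congr Some; apply: mknode_eq => //.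
exact: anc_step.
Qed.

Lemma layer_parent_top v : layer_parent (mknode d.+1 v) = None.
Proof. by rewrite /layer_parent /= inordK ?eqxx. Qed.

Lemma layer_parent_None p : layer_parent p = None -> exists v, p = mknode d.+1 v.
Proof.
have [h [v [le ->]]] := mknode_surj p; have [leh|lt] := leqP h d.
  by rewrite layer_parent_node.
by exists v; have -> : h = d.+1 by lia.
Qed.

Lemma layer_root_unique p q :
  layer_parent p = None -> layer_parent q = None -> p = q.
Proof.
move=> /layer_parent_None[u ->] /layer_parent_None[v ->].
by apply: mknode_eq => //; apply: anc_top.
Qed.

Lemma layer_root_reach p : exists2 q, layer_parent q = None &
  connect (fun y z => layer_parent z == Some y) q p.
Proof.
have [h [v [le ->]]] := mknode_surj p; exists (mknode d.+1 v); first exact: layer_parent_top.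
have [j] : exists j, h + j = d.+1 by exists (d.+1 - h); lia.
elim: j h {p} le => [|j IH] h le; first by rewrite addn0 => ->.
rewrite addnS => e; apply: connect_trans (IH h.+1 _ _) (connect1 _); rewrite ?addSn //; first by lia.
by rewrite layer_parent_node //; lia.
Qed.

Definition layer_tree : rtree := RTree layer_root_unique layer_root_reach.

Lemma up_mknode n h v : h + n <= d.+1 ->
  up n (mknode h v : layer_tree) = Some (mknode (h + n) v : layer_tree).
Proof.
elim: n => [|n IH] le; first by rewrite addn0.
rewrite -[n.+1]add1n upD IH ?addnS /=; last by lia.
by rewrite layer_parent_node //; lia.
Qed.

Lemma is_leaf_mknode h v : h <= d.+1 -> is_leaf (mknode h v : layer_tree) = (h == 0).
Proof.
move=> le; apply/forallP/eqP => [leaf|-> p].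
  case: h le leaf => // h le /(_ (mknode h v)).
  by rewrite /child /= layer_parent_node ?eqxx.
rewrite /child /=; have [l [w [lel ->]]] := mknode_surj p; have [lt|lt] := leqP l d.
  rewrite layer_parent_node //; apply/eqP => -[/(congr1 (fun i : 'I__ => i : nat))].
  by rewrite !inordK //; lia.
have -> : l = d.+1 by lia.
by rewrite layer_parent_top.
Qed.

(** [l] is the height of the lowest common ancestor of the leaves [u] and [v]. *)
Definition level u v l := [&& 0 < l, l <= d.+1, anc l u == anc l v
  & [forall i : 'I_l, anc i u != anc i v]].

Lemma level_sym u v l : level u v l = level v u l.
Proof.
rewrite /level [anc l u == _]eq_sym; congr [&& _, _, _ & _].
by apply: eq_forallb => i; rewrite eq_sym.
Qed.

Lemma levelP u v l h : level u v l -> h <= d -> (R h u == R h v) = (l <= h.+1).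
Proof.
case/and4P => _ _ /eqP el /forallP lmin leh; rewrite -rep_eq -[rep _ u]/(anc h.+1 u).
apply/eqP/idP => [e|le]; last exact: anc_le le el.
by rewrite leqNgt; apply/negP => lt; have /eqP := lmin (Ordinal lt); apply.
Qed.

Lemma tdist_level u v l : u != v ->
  tdist (mknode 0 u : layer_tree) (mknode 0 v) (2 * l) -> level u v l.
Proof.
move=> nuv dist.
have meet : exists j, anc j u == anc j v by exists d.+1; rewrite (anc_top u v).
have [j ej jmin] := ex_minnP meet.
have lej : j <= d.+1 by apply: jmin; rewrite (anc_top u v).
have j_gt0 : 0 < j by case: j ej {jmin lej} => //= e; rewrite e in nuv.
suff -> : l = j.
  rewrite /level j_gt0 lej ej /=; apply/forallP => i.
  by apply/negP => /jmin; rewrite leqNgt ltn_ord.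
suff /tdist_uniq/(_ dist) : tdist (mknode 0 u : layer_tree) (mknode 0 v) (2 * j) by lia.
have upE i w : i <= d.+1 -> up i (mknode 0 w : layer_tree) = Some (mknode i w : layer_tree).
  by move=> le; rewrite up_mknode.
apply: (tdist_meet (upE _ u (leqnn _)) _ (upE _ v (leqnn _)) _ (upE _ _ lej)).
- exact: layer_parent_top.
- exact: layer_parent_top.
- by rewrite upE // (mknode_eq lej (eqP ej)).
- move=> i lt; rewrite !upE ?(leq_trans (ltnW lt)) //.
  have lei : i <= d.+1 by lia.
  by apply/eqP => /Some_inj/(mknode_inj lei lei)[_ /eqP/jmin]; rewrite leqNgt lt.
Qed.

End LayeredTree.

Lemma layered_TMC d m k G : layered d m k G -> TMC d m k G.
Proof.
case=> L [R [col [R_step R_top R_small R_edge]]].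
pose T := layer_tree R_step R_top; pose nd h v : T := mknode d R h v.
(* [sig] records what some edge realises; by [R_edge] and [levelP], all pairs with the same colours
   and level agree with it. *)
pose sig i j l := [exists u, exists v,
  [&& u != v, col u == i, col v == j, edge u v & level d R u v l]].
have depth (r x : T) : is_root r -> is_leaf x -> tdist r x d.+1.
  move=> /eqP /= pr; have [h [v [le ->]]] := mknode_surj x.
  rewrite is_leaf_mknode // => /eqP->; apply: tdist_root => //.
  rewrite up_mknode // add0n; congr Some.
  by apply: layer_root_unique pr => //; apply: layer_parent_top.
have inj : injective (nd 0) by move=> u v /mknode_inj[].
have im (x : T) : is_leaf x <-> exists v, nd 0 v = x.
  split=> [|[v <-]]; last by rewrite is_leaf_mknode.
  have [h [v [le ->]]] := mknode_surj x.
  by rewrite is_leaf_mknode // => /eqP->; exists v.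
have range i j l : sig i j l -> 1 <= l <= d.+1.
  by case/existsP => u /existsP[v /and5P[_ _ _ _ /and4P[-> ->]]].
have sym i j l : sig i j l = sig j i l.
  have half i' j' : sig i' j' l -> sig j' i' l.
    case/existsP => u /existsP[v /and5P[n cu cv e lv]]; apply/existsP; exists v.
    by apply/existsP; exists u; rewrite eq_sym n cu cv edge_sym e level_sym.
  by apply/idP/idP; apply: half.
have edgeE (u v : G) l : u != v -> tdist (nd 0 u) (nd 0 v) (2 * l) ->
    edge u v = sig (col u) (col v) l.
  move=> nuv /(tdist_level nuv) lv; apply/idP/existsP => [e|[u' /existsP[v']]].
    by exists u; apply/existsP; exists v; rewrite nuv !eqxx e.
  case/and5P => nuv' /eqP cu /eqP cv e lv'; rewrite (R_edge u v u' v') //.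
  by move=> h le; rewrite (levelP R_step lv) // (levelP R_step lv').
exists (TreeModel depth inj im range sym edgeE) => r x /eqP pr.
have [h [v [le ->]]] := mknode_surj x => dist.
(* Height and distance from the root add up to [d.+1], so a node at distance [d] has height 1 and
   stands for a bag. *)
have h1 : h = 1.
  have : tdist (r : T) (nd h v) (d.+1 - h).
    apply: tdist_root => //; rewrite up_mknode subnKC //; congr Some.
    by apply: layer_root_unique pr => //; apply: layer_parent_top.
  by move/tdist_uniq/(_ dist); lia.
rewrite {}h1 in le dist *.
apply: leq_trans (R_small v); rewrite -(card_imset _ inj).
apply: subset_leq_card; apply/subsetP => y; rewrite inE => /andP[/im[u <-]].
move=> /connect_up[n un]; apply/imsetP; exists u => //; rewrite inE.
have un' : up d.+1 (nd 0 u) = Some (nd d.+1 u) by rewrite up_mknode.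
have ptop : parent (nd d.+1 u) = None by apply: layer_parent_top.
have len : n <= d.+1 by rewrite (up_rootE _ un' ptop) un.
move: un; rewrite up_mknode // add0n => /Some_inj/(mknode_inj len le)[-> /eqP].
by rewrite /= rep_eq.
Qed.

(** * Transductions *)

Section CopiedStructure.

Variables (d m k p K : nat) (G : sgraph) (Q : 'I_p -> {set G}).
Variables (L : finType) (R : nat -> G -> L) (col : G -> 'I_m).
Hypothesis R_step : forall h u v, R h u = R h v -> R h.+1 u = R h.+1 v.
Hypothesis R_top : forall u v, R d u = R d v.
Hypothesis R_small : forall v, #|[set u | R 0 u == R 0 v]| <= k.
Hypothesis R_edge : forall u v u' v', u != v -> u' != v' ->
  col u = col u' -> col v = col v' ->
  (forall h, h <= d -> (R h u == R h v) = (R h u' == R h v')) -> edge u v = edge u' v'.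

Let A := copy K (expand Q).

(** All copies of a vertex share its blocks: copying enlarges bags but adds no level. *)
Definition copy_rep h : A -> A := rep (fun x : G * 'I_K => R h x.1).

Definition bag_index v := index v (enum [set u | R 0 u == R 0 v]).

Definition copy_colour (x : A) : 'I_m * 'I_k.+1 * {ffun 'I_p -> bool} * 'I_K :=
  (col x.1, inord (bag_index x.1), [ffun i => x.1 \in Q i], x.2).

Lemma copy_rep_eq h (x y : A) :
  (copy_rep h x == copy_rep h y) = (R h x.1 == R h y.1).
Proof. exact: rep_eq. Qed.

Lemma bag_index_inj u v : R 0 u = R 0 v ->
  inord (bag_index u) = inord (bag_index v) :> 'I_k.+1 -> u = v.
Proof.
have mem w : w \in enum [set u | R 0 u == R 0 w] by rewrite mem_enum inE.
have lt w : bag_index w < k.+1.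
  by rewrite ltnS; apply: leq_trans (R_small w); rewrite cardE ltnW // index_mem.
move=> Ruv /(congr1 val); rewrite /= !inordK // /bag_index Ruv => eq_index.
have memu : u \in enum [set w | R 0 w == R 0 v] by rewrite -Ruv.
by rewrite -(nth_index u memu) eq_index nth_index.
Qed.

Lemma copy_hier : hier_structure d copy_rep copy_colour.
Proof.
(* Colours and the sharing of a bag decide whether two elements copy the same vertex, hence the
   relation [~]. *)
have sameE (x y x' y' : A) : copy_colour x = copy_colour x' -> copy_colour y = copy_colour y' ->
    (copy_rep 0 x == copy_rep 0 y) = (copy_rep 0 x' == copy_rep 0 y') ->
    x.1 == y.1 -> x'.1 == y'.1.
  move=> [_ ix _ _] [_ iy _ _]; rewrite !copy_rep_eq => e /eqP exy; apply/eqP.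
  apply: bag_index_inj; first by apply/eqP; rewrite -e exy.
  by rewrite -ix -iy exy.
split.
- have RK h x : R h (copy_rep h x).1 = R h x.1.
    exact: (repK (fun x : G * 'I_K => R h x.1)).
  by split=> h x; apply/eqP; rewrite copy_rep_eq; apply/eqP; [|apply: R_step].
- by move=> x y; apply/eqP; rewrite copy_rep_eq (R_top x.1 y.1).
- move=> [u i] [v j] /eqP; rewrite copy_rep_eq /= => /eqP Ruv [_ e _ ->].
  by rewrite (bag_index_inj Ruv e).
- move=> [P|i] x y [_ _ /ffunP eP e2] /=; last by rewrite e2.
  by have := eP P; rewrite !ffunE.
move=> [[]|] x y x' y' cx cy lev /=; last first.
  by apply/idP/idP; apply: sameE => //; rewrite lev.
have [[cx1 _ _ ->] [cy1 _ _ ->]] := (cx, cy); congr (_ && _).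
(* [R_edge] speaks of distinct vertices; for equal ones irreflexivity excludes edges on both
   sides. *)
have [e|ne] := eqVneq x.1 y.1.
  have /eqP e' : x'.1 == y'.1 by apply: (sameE x y) => //; rewrite ?lev ?e.
  by rewrite e e' !edge_irrefl.
apply: R_edge => //; last by move=> h le; rewrite -!copy_rep_eq lev.
by apply: contra ne; apply: sameE => //; rewrite lev.
Qed.

End CopiedStructure.

(** Vertices of [H] are copied elements and inherit their blocks, so [d] is kept; signatures become
    the colours, and bags grow at most by the factor [td_k tau]. *)
Lemma transduces_layered d m k (tau : transduction) : exists m' k', forall G H,
  layered d m k G -> transduces tau G H -> layered d m' k' H.
Proof.
have [F sgP] := binary_query_signature
  ('I_m * 'I_k.+1 * {ffun 'I_(td_p tau) -> bool} * 'I_(td_k tau))%type d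
  (bt_mu (td_basic tau)).
exists #|F|, (k * td_k tau) => G H [L [R [col [R_step R_top R_small R_edge]]]].
case=> Q /= [_ [f [g fK gK] f_mono]].
have [sg sgE] := sgP _ _ _
  (copy_hier (td_k tau) Q R_step R_top R_small R_edge).
pose pos v := val (f v).
have pos_inj : injective pos by move=> u v /val_inj /(can_inj fK).
exists L, (fun h v => R h (pos v).1), (fun v => enum_rank (sg (pos v))); split.
- by move=> h u v; apply: R_step.
- by move=> u v; apply: R_top.
- move=> v; rewrite -(card_imset _ pos_inj).
  apply: leq_trans (leq_mul (R_small (pos v).1) (leqnn _)).
  rewrite -[X in _ * X]card_ord -cardsT -cardsX; apply: subset_leq_card.
  by apply/subsetP => y /imsetP[u]; rewrite inE => Ru ->; rewrite inE in_setT andbT inE.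
move=> u v u' v' nuv nuv' /enum_rank_inj su /enum_rank_inj sv lev.
rewrite -!f_mono /= /basic_edge !(inj_eq (can_inj fK)) nuv nuv' /=.
by apply: sgE => // l le; rewrite !copy_rep_eq; apply: lev.
Qed.

Theorem theorem4p7 (d : nat) (C : graph_class) (tau : transduction) :
  1 <= d -> copying_sd d C -> copying_sd_le d (image_class tau C).
Proof.
move=> _ [[m [k CTM]] _].
have [m' [k' lay]] := transduces_layered d m k tau.
exists m', k' => H [G /CTM/TMC_layered layG tGH].
exact: layered_TMC (lay G H layG tGH).
Qed.
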